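(* Let $d,m,p,c,r \in \mathbb{Z}^+$. There exist $M,P,\mu \in \mathbb{Z}^+$ such that every $r$-coloring of any $d$-dimensional $(M,P,c^\mu)$-set contains a $d$-dimensional $(m,p,c)$-set all of whose points receive the same color.
   Context: Let $m,p,c \in \mathbb{Z}^+$. A set $S \subseteq \mathbb{Z}^+$ is called an $(m,p,c)$-set if there exist generators $g_1,\dots,g_m \in \mathbb{Z}^+$ such that $$S = \bigcup_{i=1}^m \left\{cg_i + \sum_{j=i+1}^m \lambda_j g_j : \lambda_j \in \mathbb{Z} \cap [-p,p]\right\},$$ where the empty sum equals $0$; the integers $\lambda_j$ may be negative, but all elements of $S$ are required to be positive integers. For $d\in\mathbb{Z}^+$, a $d$-dimensional $(m,p,c)$-set is a set $S_1\times S_2\times\cdots\times S_d\subseteq(\mathbb{Z}^+)^d$ where each $S_i$ is an $(m,p,c)$-set. *)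

(* Defs.v *)
From mathcomp Require Export all_boot all_order all_algebra.
From mathcomp Require Export classical_sets.

Set Implicit Arguments.
Unset Strict Implicit.
Unset Printing Implicit Defensive.

Import Order.TTheory GRing.Theory Num.Theory.

#[local] Open Scope classical_set_scope.
#[local] Open Scope ring_scope.

(* The generators g_1, ..., g_m are indexed from 0 by 'I_m. In the i-th row only
   the values lam j with i < j matter, so only those are bounded. *)
Definition mpc_union (m p c : nat) (g : 'I_m -> int) : set int :=
  \bigcup_(i in [set: 'I_m])
    [set x | exists lam : 'I_m -> int,
       (forall j : 'I_m, (i < j)%N -> - p%:Z <= lam j <= p%:Z) /\
       x = c%:Z * g i + \sum_(j < m | (i < j)%N) lam j * g j].

Definition is_mpc_set (m p c : nat) (S : set int) : Prop :=
  (forall x, S x -> 0 < x) /\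
  exists g : 'I_m -> int, (forall i, 0 < g i) /\ S = mpc_union p c g.

Definition is_dim_mpc_set (d m p c : nat) (T : set {ffun 'I_d -> int}) : Prop :=
  exists S : 'I_d -> set int,
    (forall k, is_mpc_set m p c (S k)) /\
    T = [set x : {ffun 'I_d -> int} | forall k, S k (x k)].

(* Main.v *)
(** Call the elements of an (m,p,c)-set with leading generator g_i its i-th row.
    Colouring coefficient vectors on the tail of the generators, a monochromatic
    Hales-Jewett line over the alphabet of all vectors in [-p,p]^n yields a
    subsystem whose first row is monochromatic, at the price of squaring the
    leading coefficient.  Iterating makes every row monochromatic, each with its
    own colour; keeping the generators of the most frequent colour gives Deuber's
    theorem in dimension one.

    For products, colour the first coordinate by the finite colouring it induces
    on the remaining factors and use induction on d.  Different parameters are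
    reconciled by dilating the generators by a power of c.  Positivity of the new
    generators is free, because c h_i lies in the ambient set. *)

Require Import Defs.
From mathcomp Require Import all_boot all_order all_algebra.
From mathcomp Require Import classical_sets.
From mathcomp Require Import zify ring.

Set Implicit Arguments.
Unset Strict Implicit.
Unset Printing Implicit Defensive.

Import Order.TTheory GRing.Theory Num.Theory.

Local Open Scope classical_set_scope.

(** * The Hales-Jewett theorem *)

Section HalesJewett.

(** A line is a word over [option A], with [None] at the variable positions. *)
Definition subst_line (A : Type) (L : seq (option A)) (a : A) : seq A :=
  map (odflt a) L.

Definition letters_lt (t : nat) (L : seq (option nat)) : bool :=
  all (fun o => if o is Some a then a < t else true) L.

Definition mono_line (K : Type) (t : nat) (chi : seq nat -> K)
    (L : seq (option nat)) : Prop :=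
  [/\ letters_lt t L, None \in L &
      exists k, forall a, a < t -> chi (subst_line L a) = k].

Definition hales_jewett_at (t : nat) : Prop :=
  forall K : finType, exists N, forall chi : seq nat -> K,
    exists2 L, size L = N & mono_line t chi L.

Lemma subst_line_cat (A : Type) (L1 L2 : seq (option A)) a :
  subst_line (L1 ++ L2) a = subst_line L1 a ++ subst_line L2 a.
Proof. by rewrite /subst_line map_cat. Qed.

Lemma subst_line_const (A : Type) (w : seq A) a :
  subst_line (map Some w) a = w.
Proof. by elim: w => //= b w IH; rewrite /subst_line /= -/(subst_line _ _) IH. Qed.

Lemma subst_line_lt t L a :
  a < t -> letters_lt t L -> all (fun b => b < t) (subst_line L a).
Proof.
by move=> lt_a; elim: L => //= -[b|] L IH /=; [case/andP => -> /IH | rewrite lt_a].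
Qed.

Lemma letters_ltW t u L : t <= u -> letters_lt t L -> letters_lt u L.
Proof.
move=> le_tu; apply: sub_all => -[a|] //= lt_a; exact: leq_trans lt_a le_tu.
Qed.

Lemma letters_lt_const t w :
  all (fun b => b < t) w -> letters_lt t (map Some w).
Proof. by rewrite /letters_lt all_map. Qed.

Lemma letters_lt_cat t L1 L2 :
  letters_lt t (L1 ++ L2) = letters_lt t L1 && letters_lt t L2.
Proof. exact: all_cat. Qed.

Lemma word_as_tuple t N (w : seq nat) : size w = N -> all (fun b => b < t.+1) w ->
  exists u : N.-tuple 'I_t.+1, map val u = w.
Proof.
move=> sz_w lt_w.
have sz_u : size (map (@inord t) w) == N by rewrite size_map sz_w.
exists (Tuple sz_u) => /=; rewrite -map_comp map_id_in // => b b_w /=.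
by rewrite inordK //; apply: (allP lt_w).
Qed.

(* The [Ls] pair each focused line with its colour on the letters below [t]. *)
Definition focused (K : eqType) (t N : nat) (chi : seq nat -> K) (f : seq nat)
    (Ls : seq (seq (option nat) * K)) : Prop :=
  [/\ uniq (map snd Ls), size f = N, all (fun b => b < t.+1) f &
   forall L k, (L, k) \in Ls ->
   [/\ size L = N, letters_lt t.+1 L, None \in L, subst_line L t = f &
       forall a, a < t -> chi (subst_line L a) = k]].

(** Induction on [s]. A line [L] is prepended whose letters below [t] cannot be told apart by any
    suffix of length [N], and the induction hypothesis is applied to the suffixes. If the focus has
    the colour of a focused line, that line is monochromatic for all [t.+1] letters; otherwise one
    more colour is gained. *)
Lemma focusing (K : finType) t s : 0 < t -> hales_jewett_at t ->
  exists N, forall chi : seq nat -> K,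
    (exists2 L, size L = N & mono_line t.+1 chi L) \/
    (exists f Ls, size Ls = s /\ focused t N chi f Ls).
Proof.
move=> t_gt0 HJ; elim: s => [|s [N IH]].
  by exists 0 => chi; right; exists [::], [::].
have [N' HJ'] := HJ {ffun N.-tuple 'I_t.+1 -> K}.
exists (N' + N) => chi.
have [L szL [ltL varL [k' monoL]]] :=
  HJ' (fun u => [ffun v : N.-tuple 'I_t.+1 => chi (u ++ map val v)]).
have swap a v : a < t -> size v = N -> all (fun b => b < t.+1) v ->
    chi (subst_line L a ++ v) = chi (subst_line L 0 ++ v).
  move=> lt_a szv ltv; have [u <-] := word_as_tuple szv ltv.
  have := monoL 0 t_gt0; have := monoL a lt_a.
  by move=> <- /ffunP /(_ u); rewrite !ffunE.
have extend L' : size L' = N ->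
    mono_line t.+1 (fun v => chi (subst_line L 0 ++ v)) L' ->
    exists2 L, size L = N' + N & mono_line t.+1 chi L.
  move=> szL' [ltL' varL' [k monoL']].
  exists (map Some (subst_line L 0) ++ L').
    by rewrite size_cat szL' !size_map szL.
  split.
  - rewrite letters_lt_cat; apply/andP; split=> //.
    apply: letters_lt_const; apply: subst_line_lt => //.
    exact: letters_ltW ltL.
  - by rewrite mem_cat varL' orbT.
  - exists k => a lt_a; rewrite subst_line_cat subst_line_const; exact: monoL'.
case: (IH (fun v => chi (subst_line L 0 ++ v))) => [[L' szL' monoL']|].
  by left; apply: extend monoL'.
move=> [f [Ls [szLs [uniqLs szf ltf focLs]]]].
case: (boolP (chi (subst_line L 0 ++ f) \in map snd Ls)) => [|new_k].
  case/mapP => -[L' k] LsL' /= def_k.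
  have [szL' ltL' varL' fL' monoL'] := focLs _ _ LsL'.
  left; apply: (extend L') => //; split=> //.
  exists k => a; rewrite ltnS leq_eqVlt => /orP[/eqP -> | /monoL' //].
  by rewrite fL'.
(* The new line varies on [L] only, followed by [f]; the old lines vary jointly with [L]. All reach
   the new focus at letter [t]. *)
right; exists (subst_line L t ++ f).
exists ((L ++ map Some f, chi (subst_line L 0 ++ f)) ::
        [seq (L ++ Lk.1, Lk.2) | Lk <- Ls]); split; first by rewrite /= size_map szLs.
have ltL1 : letters_lt t.+1 L by apply: letters_ltW ltL.
split.
- by rewrite /= -map_comp new_k.
- by rewrite size_cat size_map szL szf.
- by rewrite all_cat ltf andbT subst_line_lt.
move=> L' k; rewrite inE => /orP[/eqP [-> ->] | /mapP [[L1 k1] LsL1 /= [-> ->]]].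
  split=> [|||| a lt_a].
  - by rewrite size_cat size_map szL szf.
  - by rewrite letters_lt_cat ltL1 letters_lt_const.
  - by rewrite mem_cat varL.
  - by rewrite subst_line_cat subst_line_const.
  - by rewrite subst_line_cat subst_line_const swap.
have [sz1 lt1 var1 f1 mono1] := focLs _ _ LsL1.
split=> [|||| a lt_a].
- by rewrite size_cat sz1 szL.
- by rewrite letters_lt_cat ltL1 lt1.
- by rewrite mem_cat varL.
- by rewrite subst_line_cat f1.
- rewrite subst_line_cat swap ?mono1 //; first by rewrite size_map.
  by apply: subst_line_lt lt1; apply: ltnW.
Qed.

(** With [#|K|.+1] focused lines the distinct colours would not fit into [K], so a monochromatic
    line is forced. A one-letter alphabet is trivial. *)
Lemma hales_jewett_nat t : hales_jewett_at t.+1.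
Proof.
elim: t => [|t IH] K.
  exists 1 => chi; exists [:: None] => //; split=> //.
  by exists (chi [:: 0]) => -[].
have [N HN] := focusing K #|K|.+1 (ltn0Sn t) IH.
exists N => chi; case: (HN chi) => // -[f [Ls [szLs [uniqLs _ _ _]]]].
have := uniq_leq_size uniqLs (s2 := enum K) (fun x _ => mem_enum K x).
by rewrite -cardE size_map szLs ltnn.
Qed.

(** Letters are replaced by their indices in [enum A]. *)
Lemma hales_jewett (A K : finType) : A -> exists N, forall chi : seq A -> K,
  exists L, [/\ size L = N, None \in L &
                exists k, forall a, chi (subst_line L a) = k].
Proof.
move=> a0; have A_gt0 : 0 < #|A| by apply/card_gt0P; exists a0.
have [N HN] := @hales_jewett_nat #|A|.-1 K.
pose dec b := nth a0 (enum A) b.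
exists N => chi.
have [L szL [_ varL [k monoL]]] := HN (fun w => chi (map dec w)).
exists (map (omap dec) L); split; first by rewrite size_map.
  by apply/mapP; exists None.
exists k => a.
have lt_a : index a (enum A) < #|A| by rewrite cardE index_mem mem_enum.
rewrite -(monoL (index a (enum A))) ?prednK //; congr chi.
rewrite /subst_line -!map_comp; apply: eq_map => -[b|] //=.
by rewrite /dec nth_index // mem_enum.
Qed.

End HalesJewett.

(** * Sets generated by a list of integers *)

Section GeneratedSets.

Local Open Scope ring_scope.

Implicit Types (P Q B C D : nat) (s t h : seq int) (x y z : int).

Fixpoint span P s x : Prop :=
  if s is g :: s' then
    exists l y, [/\ `|l| <= P%:Z, span P s' y & x = l * g + y]
  else x = 0.

(** List form of [mpc_union]: the head gives the first row, the tail the later ones. Positivity is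
    recovered at the end from the ambient set. *)
Fixpoint mpc P C s x : Prop :=
  if s is g :: s' then
    (exists2 y, span P s' y & x = C%:Z * g + y) \/ mpc P C s' x
  else False.

Definition dil D s : seq int := [seq D%:Z * g | g <- s].

Lemma span0 P s : span P s 0.
Proof.
by elim: s => //= g s IH; exists 0, 0; split=> //; rewrite ?normr0 // mul0r addr0.
Qed.

Lemma spanW P Q s x : (P <= Q)%N -> span P s x -> span Q s x.
Proof.
move=> le_PQ; elim: s x => //= g s IH x [l [y [lP sy ->]]].
by exists l, y; split; [lia | exact: IH | ].
Qed.

Lemma spanD P Q s x y : span P s x -> span Q s y -> span (P + Q) s (x + y).
Proof.
elim: s x y => /= [|g s IH] x y; first by move=> -> ->; rewrite addr0.
move=> [l [u [lP su ->]]] [l' [u' [lQ su' ->]]].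
by exists (l + l'), (u + u'); split; [lia | exact: IH | ring].
Qed.

Lemma spanZ P D s (a : int) x :
  `|a| <= D%:Z -> span P s x -> span (D * P) s (a * x).
Proof.
move=> aD; elim: s x => /= [|g s IH] x; first by move=> ->; rewrite mulr0.
move=> [l [y [lP sy ->]]]; exists (a * l), (a * y); split; [|exact: IH|ring].
by rewrite normrM PoszM ler_pM.
Qed.

Lemma span_cons P g s x : span P s x -> span P (g :: s) x.
Proof. by move=> sx; exists 0, x; rewrite normr0 mul0r add0r. Qed.

Lemma span_subseq P s t x : subseq s t -> span P s x -> span P t x.
Proof.
elim: t s x => [|g t IH] [|g' s] x //=; first by move=> _ ->; apply: (span0 P (g :: t)).
case: eqP => [-> st [l [y [lP sy ->]]] | _ st].
  by exists l, y; split=> //; apply: (IH s).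
by move=> sx; apply: span_cons; exact: (IH (g' :: s)).
Qed.

Lemma span_cat P s t x y : span P s x -> span P t y -> span P (s ++ t) (x + y).
Proof.
elim: s x => [|g s IH] x /=; first by move=> ->; rewrite add0r.
move=> [l [z [lP sz ->]]] ty; exists l, (z + y).
by split; [|exact: IH|rewrite addrA].
Qed.

Lemma span_mem s x : x \in s -> span 1 s x.
Proof.
elim: s => //= g s IH; rewrite inE => /orP[/eqP ->|/IH sx]; last exact: span_cons.
by exists 1, 0; split; [|exact: span0|rewrite mul1r addr0].
Qed.

Lemma span_trans P B t s x : {in t, forall g, span B s g} ->
  span P t x -> span (size t * (P * B)) s x.
Proof.
elim: t x => [|g t IH] x /= sB; first by move=> ->; apply: span0.
move=> [l [y [lP ty ->]]]; rewrite mulSn; apply: spanD.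
  by apply: spanZ => //; apply: sB; rewrite mem_head.
by apply: IH => // g' tg'; apply: sB; rewrite inE tg' orbT.
Qed.

Lemma span_dil P D s x : span P (dil D s) x -> exists2 y, span P s y & x = D%:Z * y.
Proof.
elim: s x => [|g s IH] x /=; first by move=> ->; exists 0; rewrite ?mulr0.
move=> [l [y [lP /IH [z sz ->] ->]]].
by exists (l * g + z); [exists l, z | ring].
Qed.

Lemma span_dilW P D s x : span P (dil D s) x -> span (D * P) s x.
Proof. by case/span_dil => y sy ->; apply: spanZ. Qed.

Lemma mpcW P Q C s x : (P <= Q)%N -> mpc P C s x -> mpc Q C s x.
Proof.
move=> le_PQ; elim: s => //= g s IH [[y sy ->]|/IH]; last by right.
by left; exists y => //; apply: spanW sy.
Qed.

Lemma mpc_dil P C D s x : mpc P C (dil D s) x -> mpc (D * P) (C * D) s x.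
Proof.
elim: s => //= g s IH [[y sy ->]|/IH]; last by right.
by left; exists y; [exact: span_dilW | rewrite PoszM mulrA].
Qed.

Lemma mpc_subseq P C s t x : subseq s t -> mpc P C s x -> mpc P C t x.
Proof.
elim: t s => [|g t IH] [|g' s] //=.
case: eqP => [-> st [[y sy ->]|mx] | _ st mx].
- by left; exists y => //; apply: span_subseq sy.
- by right; apply: IH mx.
- by right; exact: (IH (g' :: s)).
Qed.

Lemma mpc_catr P C s t x : mpc P C t x -> mpc P C (s ++ t) x.
Proof. exact/mpc_subseq/suffix_subseq. Qed.

(** Dilation raises the exponent to a common [nu] and [take N] allows a common length, so that sets
    with different parameters fit into one ambient set. *)
Lemma mpc_weaken P Q c mu nu N s x : (mu <= nu)%N -> (c ^ (nu - mu) * P <= Q)%N ->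
  mpc P (c ^ mu) (dil (c ^ (nu - mu)) (take N s)) x -> mpc Q (c ^ nu) s x.
Proof.
move=> le_mu le_Q /mpc_dil; rewrite -expnD subnKC // => /(mpcW le_Q).
exact/mpc_subseq/take_subseq.
Qed.

(** * Linear combinations given by coefficient lists *)

Fixpoint dot (l s : seq int) : int :=
  match l, s with a :: l', g :: s' => a * g + dot l' s' | _, _ => 0 end.

Definition padd (s t : seq int) : seq int := [seq u.1 + u.2 | u <- zip s t].

Lemma span_dot P l s : size l = size s ->
  all (fun a => `|a| <= P%:Z) l -> span P s (dot l s).
Proof.
elim: s l => [|g s IH] [|a l] //= [sz] /andP[aP lP].
by exists a, (dot l s); split=> //; apply: IH.
Qed.

Lemma spanP P s x : span P s x ->
  exists l, [/\ size l = size s, all (fun a => `|a| <= P%:Z) l & x = dot l s].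
Proof.
elim: s x => [|g s IH] x /=; first by move=> ->; exists [::].
move=> [l [y [lP /IH [ls [sz lsP ->]] ->]]].
by exists (l :: ls); rewrite /= sz lP.
Qed.

Lemma dot_padd l s t : size s = size t -> dot l (padd s t) = dot l s + dot l t.
Proof.
elim: l s t => [|a l IH] [|x s] [|y t] //= [sz].
by rewrite -/(padd s t) IH //; ring.
Qed.

Lemma size_padd s t : size s = size t -> size (padd s t) = size s.
Proof. by move=> sz; rewrite size_map size1_zip // sz. Qed.

Lemma span_padd P s t x : size s = size t -> span P (padd s t) x ->
  exists y z, [/\ span P s y, span P t z & x = y + z].
Proof.
move=> sz /spanP [l [szl lP ->]]; rewrite size_padd // in szl.
exists (dot l s), (dot l t); split; rewrite ?dot_padd //; apply: span_dot => //.
by rewrite szl.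
Qed.

Lemma mem_padd s t x : x \in padd s t -> exists y z, [/\ y \in s, z \in t & x = y + z].
Proof.
case/mapP => -[y z] /= yz ->; exists y, z.
suff /andP[ys zt] : (y \in s) && (z \in t) by [].
elim: s t yz => [|a s IH] [|b t] //=; rewrite !inE => /orP[/eqP [-> ->]|/IH].
  by rewrite !eqxx.
by case/andP => -> ->; rewrite !orbT.
Qed.

(** In a generator [a + b], the summand [a] keeps the leading coefficient [C * C], while [b] and the
    tail from [t] are rewritten over [u], which follows all of [s]. They cost [C * C] and
    [C * (size t * P)] in the new bound. *)
Lemma mpc_padd P C Q s t u x : size s = size t ->
  {in t, forall g, span 1 u g} -> (C * C + C * (size t * P) <= Q)%N ->
  mpc P C (dil C (padd s t)) x -> mpc Q (C * C) (s ++ u) x.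
Proof.
elim: s t => [|a s IH] [|b t] //= [sz] tu le_Q; rewrite -/(padd s t).
have tu' : {in t, forall g, span 1 u g} by move=> g tg; apply: tu; rewrite inE tg orbT.
case=> [[y /span_dil [z stz ->] ->] | mx]; last first.
  by right; apply: IH mx => //; nia.
have le_Q' : (C * C + C * (size t * P) <= Q)%N by nia.
left; have [z1 [z2 [sz1 /(span_trans tu') uz2 ->]]] := span_padd sz stz.
exists (C%:Z * z1 + ((C * C)%N%:Z * b + C%:Z * z2)); last by rewrite PoszM; ring.
apply: span_cat.
  by apply: (@spanW (C * P)); [nia | apply: spanZ].
apply: (spanW le_Q'); apply: spanD.
  by rewrite -[X in span X]muln1; apply: spanZ => //; apply: tu; rewrite mem_head.
by apply: (@spanW (C * (size t * (P * 1)))); [nia | apply: spanZ].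
Qed.

(** * Combinatorial lines evaluated on blocks of generators *)

Section Lines.

Variables (A : eqType) (n : nat) (dec : A -> seq int).
Hypothesis size_dec : forall a, size (dec a) = n.

(** Each letter codes [n] coefficients for its own block of [n] generators. *)
Fixpoint word_val (w : seq A) s : int :=
  if w is a :: w' then dot (dec a) (take n s) + word_val w' (drop n s) else 0.

Fixpoint line_vec (L : seq (option A)) s : seq int :=
  match L with
  | None :: L' => padd (take n s) (line_vec L' (drop n s))
  | Some _ :: L' => line_vec L' (drop n s)
  | [::] => nseq n 0
  end.

Fixpoint line_const (L : seq (option A)) s : int :=
  match L with
  | None :: L' => line_const L' (drop n s)
  | Some a :: L' => dot (dec a) (take n s) + line_const L' (drop n s)
  | [::] => 0
  end.

Lemma size_block (k : nat) s : size s = (k.+1 * n)%N ->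
  size (take n s) = n /\ size (drop n s) = (k * n)%N.
Proof.
by move=> sz; rewrite size_drop sz mulSn addKn size_takel // sz mulSn leq_addr.
Qed.

Lemma size_line_vec L s : size s = (size L * n)%N -> size (line_vec L s) = n.
Proof.
elim: L s => [|[a|] L IH] s /=; first by rewrite size_nseq.
  by case/size_block => _ /IH.
by case/size_block => sz1 /IH sz2; rewrite size_padd ?sz1.
Qed.

(** The variable positions share one coefficient vector, so their blocks add up; the fixed positions
    give the constant. *)
Lemma word_val_line L s a : size s = (size L * n)%N ->
  word_val (subst_line L a) s = line_const L s + dot (dec a) (line_vec L s).
Proof.
elim: L s => [|[b|] L IH] s /=.
- by move=> _; rewrite add0r; elim: (dec a) n => [|x l IHl] [|k] //=; rewrite -IHl mulr0.
- by case/size_block => _ /IH ->; rewrite addrA.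
- case/size_block => sz1 sz2; rewrite IH // dot_padd ?size_line_vec //; ring.
Qed.

(** The blocks are disjoint, so each position of [s] is used at most once. *)
Lemma line_vec_span L s : size s = (size L * n)%N ->
  {in line_vec L s, forall g, span 1 s g}.
Proof.
elim: L s => [|[a|] L IH] s /=.
- by move=> _ g; rewrite mem_nseq => /andP[_ /eqP ->]; apply: span0.
- case/size_block => _ /IH IHs g /IHs sg.
  by rewrite -[s](cat_take_drop n) -[g]add0r; apply: span_cat => //; apply: span0.
- case/size_block => sz1 sz2 g /mem_padd [y [z [sy sz ->]]].
  rewrite -[X in span 1 X](cat_take_drop n); apply: span_cat; first exact: span_mem.
  exact: IH.
Qed.

Lemma line_const_span P L s : (forall a, all (fun b => `|b| <= P%:Z) (dec a)) ->
  size s = (size L * n)%N -> span P s (line_const L s).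
Proof.
move=> decP; elim: L s => [|[a|] L IH] s /=; first by move=> _; apply: span0.
  case/size_block => sz1 sz2; rewrite -[X in span P X](cat_take_drop n).
  by apply: span_cat; [apply: span_dot; rewrite ?size_dec | apply: IH].
case/size_block => sz1 sz2; rewrite -[X in span P X](cat_take_drop n) -[line_const _ _]add0r.
by apply: span_cat; [apply: span0 | apply: IH].
Qed.

(* The blocks before the first variable one are skipped; that block provides
   the leading generators, in order, and later blocks only enter the tails. *)
Lemma line_vec_mpc P C Q L s x : size s = (size L * n)%N -> None \in L ->
  (C * C + C * (n * P) <= Q)%N ->
  mpc P C (dil C (line_vec L s)) x -> mpc Q (C * C) s x.
Proof.
move=> sz varL le_Q; elim: L s sz varL => [|[a|] L IH] s //=.
  case/size_block => _ sz2; rewrite inE /= => varL /IH mx.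
  by rewrite -[s](cat_take_drop n); apply: mpc_catr; apply: mx.
case/size_block => sz1 sz2 _ mx; rewrite -[s](cat_take_drop n).
apply: mpc_padd mx; rewrite ?size_line_vec //; exact: line_vec_span.
Qed.

End Lines.

Definition coef_dec n P (a : n.-tuple 'I_(2 * P).+1) : seq int :=
  [seq (val i)%:Z - P%:Z | i <- a].

Lemma coef_decP n P a : all (fun b => `|b| <= P%:Z) (@coef_dec n P a).
Proof. by rewrite all_map; apply/allP => i _ /=; have := ltn_ord i; lia. Qed.

(** Ensures that every element of the first row comes from a letter. *)
Lemma coef_dec_surj n P (l : seq int) : size l = n ->
  all (fun b => `|b| <= P%:Z) l -> exists a : n.-tuple _, @coef_dec n P a = l.
Proof.
move=> sz lP.
have sza : size (map (fun b : int => @inord (2 * P) (absz (b + P%:Z))) l) == n.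
  by rewrite size_map sz.
exists (Tuple sza); rewrite /coef_dec /= -map_comp map_id_in // => b /(allP lP) bP /=.
rewrite inordK; lia.
Qed.

(* The fixed letters of a monochromatic line go into [h0], which must absorb a
   factor [C]; this is what squares the leading coefficient. *)
Lemma mono_first_row (K : finType) n P C : exists N P1 Q,
  forall (g0 : int) s (chi : int -> K), size s = N -> exists (h0 : int) h,
  [/\ size h = n,
      exists k, forall x, span P h x -> chi (C%:Z * h0 + x) = k,
      forall x, mpc P C (h0 :: h) x -> mpc P1 (C * C) (g0 :: s) x &
      forall x, span P (h0 :: h) x -> span Q (g0 :: s) x].
Proof.
have a0 : n.-tuple 'I_(2 * P).+1 by exact: [tuple of nseq n ord0].
have [N HN] := hales_jewett K a0.
set dec := @coef_dec n P.
have size_dec a : size (dec a) = n by rewrite size_map size_tuple.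
(* The second constant bounds both the tail [C * (P + n * P)] below [h0] and the rows of [h]; in the
   third, each of the [n.+1] new generators has coefficients at most [C + P]. *)
exists (N * n)%N, (C * C + C * (P + n * P))%N, ((n.+1) * (P * (C + P)))%N.
move=> g0 s chi szs.
have [L [szL varL [k monoL]]] :=
  HN (fun w => chi (C%:Z * C%:Z * g0 + C%:Z * word_val n dec w s)).
have szsL : size s = (size L * n)%N by rewrite szL.
pose v := line_vec n L s; have szv : size v = n by apply: size_line_vec.
(* With this choice, [C * h0] plus an element of the tail is the coloured value of a point on the
   line. *)
exists (C%:Z * g0 + line_const n dec L s), (dil C v).
have Lspan : span P s (line_const n dec L s).
  by apply: line_const_span => // a; apply: coef_decP.
have vspan : {in v, forall g, span 1 s g} by apply: line_vec_span.
split; first by rewrite size_map.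
- exists k => x /span_dil [y /spanP [l [szl lP ->]] ->].
  have [a def_l] := coef_dec_surj (etrans szl szv) lP.
  rewrite -(monoL a) word_val_line // -/dec -/v -def_l; congr chi; ring.
- move=> x [[y /span_dil [z vz ->] ->] | mx].
    left; exists (C%:Z * (line_const n dec L s + z)); last by rewrite PoszM; ring.
    have sz : span (n * P) s z by rewrite -szv -(muln1 P); apply: span_trans vz.
    apply: (spanW (leq_addl _ _)); apply: spanZ => //.
    exact: spanD.
  right; apply: line_vec_mpc mx => //; nia.
- move=> x hx; have -> : n.+1 = size ((C%:Z * g0 + line_const n dec L s) :: dil C v).
    by rewrite /= size_map szv.
  apply: span_trans hx => g; rewrite inE => /orP[/eqP -> | /mapP [w vw ->]].
    exists C%:Z, (line_const n dec L s); split=> //; first by lia.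
    by apply: spanW Lspan; apply: leq_addl.
  apply: span_cons; apply: (@spanW (C * 1)); first by rewrite muln1 leq_addr.
  by apply: spanZ => //; apply: vspan.
Qed.

(** * Deuber's theorem *)

Fixpoint row_colours (K : Type) (chi : int -> K) P C (ks : seq K) s : Prop :=
  match ks, s with
  | k :: ks', g :: s' =>
      (forall y, span P s' y -> chi (C%:Z * g + y) = k) /\ row_colours chi P C ks' s'
  | [::], [::] => True
  | _, _ => False
  end.

(** Induction on [n]: the first row is made monochromatic over a long tail [h], and the hypothesis
    is applied to [h]. The new tail [e] has its span inside a bounded span of [h], so the first row
    keeps its colour. The span clause carries this bound along, and [0 < mu] lets a factor [c] be
    split off. *)
Lemma mono_rows (K : finType) n p c : exists N P mu Q, (0 < mu)%N /\
  forall s (chi : int -> K), size s = N -> exists h ks,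
  [/\ size h = n, row_colours chi p c ks h,
      forall x, mpc p c h x -> mpc P (c ^ mu) s x &
      forall x, span p h x -> span Q s x].
Proof.
elim: n => [|n [N' [P' [mu' [Q' [mu_gt0 IH]]]]]].
  exists 0%N, 0%N, 1%N, 0%N; split=> // s chi /size0nil ->.
  by exists [::], [::]; split.
(* The summands cover the rows of [e], its tails, and the rescaled coefficient of [h0]. *)
pose P'' := (P' + Q' + p * c ^ mu'.-1)%N.
have [N1 [P1 [Q1 H1]]] := mono_first_row K N' P'' (c ^ mu').
exists N1.+1, P1, (mu' + mu')%N, Q1; split; first by lia.
case=> [|g0 s] chi //= [szs].
have [h0 [h [szh [k mono_h0] mpc_h span_h]]] := H1 g0 s chi szs.
have [e [ks [sze col_e mpc_e span_e]]] := IH h chi szh.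
have span_e'' x : span p e x -> span P'' h x.
  by move=> /span_e; apply: spanW; rewrite /P''; lia.
have c_mu : (c ^ mu')%N%:Z = c%:Z * (c ^ mu'.-1)%N%:Z.
  by rewrite -PoszM -expnS prednK.
(* The first row has leading coefficient [c ^ mu']; moving [c ^ mu'.-1] into the generator leaves
   the required [c]. *)
exists ((c ^ mu'.-1)%N%:Z * h0 :: e), (k :: ks); split=> /=.
- by rewrite sze.
- split=> // y /span_e'' hy; rewrite mulrA -c_mu; exact: mono_h0.
- rewrite expnD => x mx; apply: mpc_h.
  case: mx => [[y /span_e'' hy ->] | /mpc_e mx].
    by left; exists y => //; rewrite mulrA -c_mu.
  by right; apply: mpcW mx; rewrite /P''; lia.
- move=> x [l [y [lp /span_e'' hy ->]]]; apply: span_h.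
  exists (l * (c ^ mu'.-1)%N%:Z), y; split=> //; last by rewrite mulrA.
  rewrite normrM; apply: (@le_trans _ _ (p * c ^ mu'.-1)%N%:Z).
    by rewrite PoszM ler_pM.
  by rewrite /P''; lia.
Qed.

Lemma size_row_colours (K : Type) (chi : int -> K) P C ks s :
  row_colours chi P C ks s -> size ks = size s.
Proof. by elim: ks s => [|k ks IH] [|g s] //= [_ /IH ->]. Qed.

(** Dropping generators only shrinks the tails, so the remaining rows keep their colours. *)
Lemma row_colours_mask (K : eqType) (chi : int -> K) P C ks s k x :
  row_colours chi P C ks s ->
  mpc P C (mask [seq k' == k | k' <- ks] s) x -> chi x = k.
Proof.
elim: ks s => [|k' ks IH] [|g s] //= [mono_g /IH col_s].
case: eqP => [eq_k|_] /=; last exact: col_s.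
case=> [[y sy ->]|]; last exact: col_s.
by rewrite -eq_k; apply: mono_g; apply: span_subseq sy; apply: mask_subseq.
Qed.

(** Pigeonhole: the multiplicities of the colours sum to [size ks]. *)
Lemma frequent_colour (K : finType) n (ks : seq K) :
  (#|K| * n < size ks)%N -> exists k, (n < count_mem k ks)%N.
Proof.
move=> lt_ks; apply/existsP; apply: contraLR lt_ks => /existsPn le_n.
rewrite -leqNgt -sum_nat_const.
have -> : size ks = (\sum_(k in K) count_mem k ks)%N.
  elim: ks {le_n} => [|k ks IH] /=; first by rewrite big1.
  rewrite big_split /= -IH (bigD1 k) //= eqxx big1 // => k' /negPf.
  by rewrite eq_sym => ->.
by apply: leq_sum => k _; rewrite leqNgt.
Qed.

Lemma deuber (K : finType) m p c : exists N P mu, (0 < mu)%N /\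
  forall s (chi : int -> K), size s = N -> exists2 h, size h = m &
  (forall x, mpc p c h x -> mpc P (c ^ mu) s x) /\
  exists k, forall x, mpc p c h x -> chi x = k.
Proof.
have [N [P [mu [Q [mu_gt0 H]]]]] := mono_rows K (#|K| * m).+1 p c.
exists N, P, mu; split=> // s chi szs.
have [h [ks [szh col_h mpc_h _]]] := H s chi szs.
have szks := size_row_colours col_h.
have [|k lt_m] := @frequent_colour K m ks; first by rewrite szks szh.
set b := [seq k' == k | k' <- ks].
exists (take m (mask b h)).
  rewrite size_takel // size_mask ?size_map // count_map.
  by apply: ltnW; rewrite (eq_count (a2 := pred1 k)).
split=> [x mx|].
  apply: mpc_h; apply: mpc_subseq mx.
  exact: subseq_trans (take_subseq _ _) (mask_subseq _ _).
exists k => x mx; apply: row_colours_mask col_h _.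
by apply: mpc_subseq mx; apply: take_subseq.
Qed.

(** * Products *)

Definition pmem P C (ss : seq (seq int)) (xs : seq int) : Prop :=
  size xs = size ss /\ forall i, (i < size ss)%N -> mpc P C (nth [::] ss i) xs`_i.

Lemma pmem_cons P C s ss x xs :
  pmem P C (s :: ss) (x :: xs) -> mpc P C s x /\ pmem P C ss xs.
Proof.
case=> -[sz] mem_xs; split; first exact: (mem_xs 0%N).
by split=> // i lt_i; apply: (mem_xs i.+1).
Qed.

(** * Enumeration of points *)

(** Points are listed with repetition, one per choice of coefficients: the length then depends only
    on the number of generators, so the colour set of the product argument can be fixed in
    advance. *)
Fixpoint span_enum P s : seq int :=
  if s is g :: s' then
    [seq (i%:Z - P%:Z) * g + y | i <- iota 0 (2 * P + 1), y <- span_enum P s']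
  else [:: 0].

Fixpoint mpc_enum P C s : seq int :=
  if s is g :: s' then [seq C%:Z * g + y | y <- span_enum P s'] ++ mpc_enum P C s'
  else [::].

Fixpoint pmem_enum P C (ss : seq (seq int)) : seq (seq int) :=
  if ss is s :: ss' then [seq x :: xs | x <- mpc_enum P C s, xs <- pmem_enum P C ss']
  else [:: [::]].

Lemma mem_span_enum P s x : span P s x -> x \in span_enum P s.
Proof.
elim: s x => [|g s IH] x /=; first by move=> ->; rewrite inE.
move=> [l [y [lP /IH sy ->]]]; apply/allpairsP; exists (absz (l + P%:Z), y).
by rewrite mem_iota; split=> //=; [lia | congr (_ * _ + _); lia].
Qed.

Lemma mem_mpc_enum P C s x : mpc P C s x -> x \in mpc_enum P C s.
Proof.
elim: s => //= g s IH; rewrite mem_cat => -[[y sy ->] | /IH ->]; last exact: orbT.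
by rewrite map_f // mem_span_enum.
Qed.

Lemma mem_pmem_enum P C ss xs : pmem P C ss xs -> xs \in pmem_enum P C ss.
Proof.
elim: ss xs => [|s ss IH] [|x xs] /=; [by []| by case | by case |].
by case/pmem_cons => mx /IH mxs; apply/allpairsP; exists (x, xs); rewrite mem_mpc_enum.
Qed.

Lemma size_span_enum P s t : size s = size t -> size (span_enum P s) = size (span_enum P t).
Proof. by elim: s t => [|g s IH] [|g' t] //= [/IH sz]; rewrite !size_allpairs sz. Qed.

Lemma size_mpc_enum P C s t :
  size s = size t -> size (mpc_enum P C s) = size (mpc_enum P C t).
Proof.
elim: s t => [|g s IH] [|g' t] //= [sz].
by rewrite !size_cat !size_map (size_span_enum P sz) (IH t).
Qed.

Lemma size_pmem_enum P C ss tt : map size ss = map size tt ->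
  size (pmem_enum P C ss) = size (pmem_enum P C tt).
Proof.
elim: ss tt => [|s ss IH] [|t tt] //= [sz /IH szs].
by rewrite !size_allpairs szs (size_mpc_enum _ _ sz).
Qed.

(* The first coordinate is coloured by the function it induces on the product
   of the others, which has boundedly many points. *)
Lemma deuber_product d (K : finType) m p c : (0 < m)%N -> exists N P mu, (0 < mu)%N /\
  forall ss (chi : seq int -> K), map size ss = nseq d N ->
  exists2 hs, map size hs = nseq d m &
  (forall i, (i < d)%N -> forall x,
     mpc p c (nth [::] hs i) x -> mpc P (c ^ mu) (nth [::] ss i) x) /\
  exists k, forall xs, pmem p c hs xs -> chi xs = k.
Proof.
move=> m_gt0; elim: d => [|d [N2 [P2 [mu2 [mu2_gt0 H2]]]]].
  exists 0%N, 0%N, 1%N; split=> // ss chi _; exists [::] => //; split=> //.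
  by exists (chi [::]) => -[|x xs] // [].
(* The zeros are placeholders, as only the list lengths affect the count. *)
pose q := size (pmem_enum P2 (c ^ mu2) (nseq d (nseq N2 0))).
have [N1 [P1 [mu1 [mu1_gt0 H1]]]] := deuber {ffun 'I_q -> K} m p c.
pose mu := (mu1 + mu2)%N.
exists (N1 + N2)%N, (c ^ (mu - mu1) * P1 + c ^ (mu - mu2) * P2)%N, mu.
split=> [|[|s0 ss] chi //= [szs0 szss]]; first by rewrite /mu; lia.
have szss_d : size ss = d by rewrite -(size_map size) szss size_nseq.
pose s0' := dil (c ^ (mu - mu1)) (take N1 s0).
pose ss' := [seq dil (c ^ (mu - mu2)) (take N2 s) | s <- ss].
have szss' : map size ss' = nseq d N2.
  have -> : d = size (map size ss') by rewrite !size_map.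
  apply/all_pred1P; rewrite !all_map; apply/allP => s ss_s /=.
  have : size s \in nseq d (N1 + N2) by rewrite -szss map_f.
  by rewrite mem_nseq size_map => /andP[_ /eqP szs]; rewrite size_takel // szs leq_addl.
have szE : size (pmem_enum P2 (c ^ mu2) ss') = q.
  by apply: size_pmem_enum; rewrite szss' map_nseq size_nseq.
set E := pmem_enum _ _ _ in szE.
have [|h0 szh0 [mpc_h0 [k0 mono_h0]]] :=
  H1 s0' (fun x => [ffun i : 'I_q => chi (x :: nth [::] E i)]).
  by rewrite size_map size_takel // szs0 leq_addr.
(* Any point of the first factor can represent all others; one exists since [0 < m]. *)
have [x0 mx0] : exists x, mpc p c h0 x.
  case: h0 szh0 {mpc_h0 mono_h0} => [sz|g h0 _]; first by rewrite -sz in m_gt0.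
  by exists (c%:Z * g + 0); left; exists 0 => //; apply: span0.
have [hs szhs [mpc_hs [k mono_hs]]] := H2 ss' (fun xs => chi (x0 :: xs)) szss'.
have szhs_d : size hs = d by rewrite -(size_map size) szhs size_nseq.
exists (h0 :: hs); first by rewrite /= szh0 szhs.
split=> [[_ x /= /mpc_h0 | i lt_i x /= /(mpc_hs i lt_i)] | ].
- by apply: mpc_weaken; rewrite ?leq_addr.
- rewrite (nth_map [::]) ?szss_d //.
  by apply: mpc_weaken; rewrite ?leq_addl.
exists k => -[|x xs]; first by case.
case/pmem_cons => mx mxs; rewrite -(mono_hs xs mxs).
(* [E] lists the ambient product of [ss'], because [hs] is chosen only after [h0]. *)
have Exs : xs \in E.
  apply: mem_pmem_enum; case: mxs => szxs mxs.
  have szss'_d : size ss' = d by rewrite size_map.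
  split=> [|i]; first by rewrite szxs szhs_d.
  by rewrite szss'_d => lt_i; apply: mpc_hs => //; apply: mxs; rewrite szhs_d.
have lt_xs : (index xs E < q)%N by rewrite -szE index_mem.
have := mono_h0 _ mx; rewrite -(mono_h0 _ mx0) => /ffunP /(_ (Ordinal lt_xs)).
by rewrite !ffunE /= nth_index.
Qed.

(** * Comparison with [mpc_union] *)

Lemma span_nthP P s y : span P s y <-> exists lam : nat -> int,
  (forall j, (j < size s)%N -> `|lam j| <= P%:Z) /\ y = \sum_(j < size s) lam j * s`_j.
Proof.
elim: s y => [|g s IH] y /=.
  by split=> [->|[lam [_ ->]]]; [exists (fun=> 0) | ]; rewrite big_ord0.
split=> [[l [z [lP /IH [lam [lamP ->]] ->]]] | [lam [lamP ->]]].
  exists (fun j => if j is j'.+1 then lam j' else l).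
  by rewrite big_ord_recl; split=> // -[|j] //= /lamP.
rewrite big_ord_recl /=.
exists (lam 0%N), (\sum_(j < size s) lam j.+1 * s`_j); split=> //; first exact: lamP.
by apply/IH; exists (fun j => lam j.+1); split=> // j lt_j; apply: lamP.
Qed.

Lemma mpc_nthP P C s x : mpc P C s x <-> exists2 i, (i < size s)%N &
  exists2 y, span P (drop i.+1 s) y & x = C%:Z * s`_i + y.
Proof.
elim: s x => [|g s IH] x /=; first by split=> // -[].
split=> [[[y sy ->] | /IH [i lt_i [y sy ->]]] | [[|i] lt_i [y sy ->]]].
- by exists 0%N => //; exists y; rewrite ?drop0.
- by exists i.+1 => //; exists y.
- by left; exists y; rewrite // -[s]drop0.
- by right; apply/IH; exists i => //; exists y.
Qed.

Lemma sum_gt_shift (F : nat -> int) (m i : nat) :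
  \sum_(j < m | (i < j)%N) F j = \sum_(j < m - i.+1) F (j + i.+1)%N.
Proof.
rewrite -(big_geq_mkord _ _ xpredT) -[X in \sum_(X <= _ < _) _]add0n big_addn.
exact: big_mkord.
Qed.

Lemma mpc_unionE m p c (g : 'I_m -> int) s x : size s = m ->
  (forall i : 'I_m, g i = s`_i) -> mpc_union p c g x <-> mpc p c s x.
Proof.
move=> sz gE; rewrite mpc_nthP /mpc_union; split.
- case=> i _ [lam [lamP ->]]; exists (val i); first by rewrite sz ltn_ord.
  exists (\sum_(j < m | (i < j)%N) lam j * g j); last by rewrite gE.
  apply/span_nthP; pose lam' (j : nat) := if insub j is Some j' then lam j' else 0 : int.
  exists (fun j => lam' (j + i.+1)%N); split=> [j|].
    rewrite size_drop sz ltn_subRL addnC => lt_j; rewrite /lam' insubT.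
    by rewrite ler_norml; apply: lamP; rewrite /= leq_addl.
  rewrite (eq_bigr (fun j : 'I_m => lam' j * s`_j)); last first.
    by move=> j _; rewrite /lam' valK gE.
  rewrite (sum_gt_shift (fun j => lam' j * s`_j)) size_drop sz.
  by apply: eq_bigr => j _; rewrite nth_drop addnC.
- case=> i; rewrite sz => lt_i [y /span_nthP [lam [lamP ->]] ->].
  (* Only indices above [i] matter, where the truncated subtraction is exact. *)
  exists (Ordinal lt_i) => //=; exists (fun j : 'I_m => lam (j - i.+1)%N); split.
    move=> j lt_j; rewrite -ler_norml; apply: lamP.
    by rewrite size_drop sz ltn_sub2r // (leq_ltn_trans lt_j).
  rewrite gE /=; congr (_ + _).
  rewrite (eq_bigr (fun j : 'I_m => lam (j - i.+1)%N * s`_j)); last first.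
    by move=> j _; rewrite gE.
  rewrite (sum_gt_shift (fun j => lam (j - i.+1)%N * s`_j)) size_drop sz.
  by apply: eq_bigr => j _; rewrite nth_drop addnC addnK.
Qed.

Lemma nth_map_ord (T : Type) (n : nat) (x0 : T) (f : 'I_n -> T) (k : 'I_n) :
  nth x0 (map f (enum 'I_n)) k = f k.
Proof. by rewrite (nth_map k) ?size_enum_ord ?ltn_ord // nth_ord_enum. Qed.

Lemma size_map_ord (T : Type) (n : nat) (f : 'I_n -> T) :
  size (map f (enum 'I_n)) = n.
Proof. by rewrite size_map size_enum_ord. Qed.

Lemma mpc_set_of_sub m p c h (S : set int) : (0 < c)%N -> size h = m ->
  (forall x, S x -> 0 < x) -> (forall x, mpc p c h x -> S x) ->
  is_mpc_set m p c (mpc_union p c (fun i : 'I_m => h`_i)).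
Proof.
move=> c_gt0 szh S_gt0 sub_hS; split=> [x|].
  by rewrite (mpc_unionE _ _ _ szh) // => /sub_hS /S_gt0.
exists (fun i : 'I_m => h`_i); split=> // i.
(* With zero tail, [c] times the generator is itself an element of [S]. *)
suff : 0 < c%:Z * h`_i + 0 by rewrite addr0 pmulr_rgt0.
apply/S_gt0/sub_hS/mpc_nthP; exists (val i); first by rewrite szh ltn_ord.
by exists 0 => //; apply: span0.
Qed.

End GeneratedSets.

(** * Products of sets, translated from lists *)

Theorem theorem12 (d m p c r : nat)
    (hd : (0 < d)%N) (hm : (0 < m)%N) (hp : (0 < p)%N) (hc : (0 < c)%N)
    (hr : (0 < r)%N) :
  exists M P mu : nat, (0 < M)%N /\ (0 < P)%N /\ (0 < mu)%N /\
    forall T : set {ffun 'I_d -> int},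
      is_dim_mpc_set M P (c ^ mu)%N T ->
      forall chi : {ffun 'I_d -> int} -> 'I_r,
        exists U : set {ffun 'I_d -> int},
          is_dim_mpc_set m p c U /\ U `<=` T /\
          exists a : 'I_r, forall x : {ffun 'I_d -> int}, U x -> chi x = a.
Proof.
have [N [P [mu [mu_gt0 H]]]] := deuber_product d 'I_r p c hm.
(* Successors guarantee positivity; [take N] drops the extra generator and [mpcW] absorbs the larger
   bound. *)
exists N.+1, P.+1, mu; do 3?split=> //; move=> T [S [SP ->]] chi.
have [g gP] := fin_all_exists (fun k => (SP k).2).
pose sk k := map (g k) (enum 'I_N.+1).
have SE k x : mpc P.+1 (c ^ mu) (sk k) x -> S k x.
  case: (gP k) => _ -> /=; apply: (mpc_unionE _ _ _ _ _).2 => [|i].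
    exact: size_map_ord.
  by rewrite nth_map_ord.
pose ss := [seq take N (sk k) | k <- enum 'I_d].
have szss : map size ss = nseq d N.
  rewrite -[in RHS](size_enum_ord d) -(size_map (take N \o sk)) -(size_map size).
  apply/all_pred1P; rewrite !all_map; apply/allP => k _ /=.
  by rewrite size_takel // size_map_ord.
have [hs szhs [sub_hs [a mono_hs]]] :=
  H ss (fun xs => chi [ffun k : 'I_d => nth 0%R xs k]) szss.
have szhs_d : size hs = d by rewrite -(size_map size) szhs size_nseq.
have szh (k : 'I_d) : size (nth [::] hs k) = m.
  by rewrite -(nth_map [::] 0%N) ?szhs ?nth_nseq ?szhs_d ltn_ord.
have sub_S (k : 'I_d) x : mpc p c (nth [::] hs k) x -> S k x.
  move=> /(sub_hs k (ltn_ord k)); rewrite nth_map_ord => /(mpcW (leqnSn P)) mx.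
  by apply: SE; apply: mpc_subseq mx; apply: take_subseq.
pose V (k : 'I_d) := mpc_union p c (fun i : 'I_m => nth 0%R (nth [::] hs k) i).
have VE k x : V k x -> mpc p c (nth [::] hs k) x.
  exact: (mpc_unionE _ _ _ (szh k) _).1.
exists [set x : {ffun 'I_d -> int} | forall k, V k (x k)]; split; last split.
- exists V; split=> // k.
  exact: mpc_set_of_sub hc (szh k) (SP k).1 (@sub_S k).
- by move=> x Vx k; apply/sub_S/VE/Vx.
exists a => x Vx; rewrite -(mono_hs (map x (enum 'I_d))).
  by congr chi; apply/ffunP => k; rewrite ffunE nth_map_ord.
split=> [|i]; rewrite ?size_map_ord szhs_d // => lt_i.
by rewrite (nth_map_ord _ _ (Ordinal lt_i)); exact: (VE (Ordinal lt_i) _ (Vx _)).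
Qed.
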